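(* Let $0\le N_1\le N$ be integers with $N\ge1$, let $x_1,\dots,x_N\in\mathbb R$, and let $$K(x)=\prod_{i=1}^{N_1}(x-x_i)^{\alpha_i}\prod_{i=N_1+1}^{N}(1-x_ix)^{\beta_i},\qquad \alpha_i,\beta_i\in\mathbb R,\ |\alpha_i|<1,\ |\beta_i|<1,$$ considered on an interval on which $K$ is real and nonzero. Assume $\lambda:=(-1)^{N-N_1}\prod_{i=N_1+1}^{N}x_i\neq0$. Let $P$ and $\phi_m$ be as in the context. Assume that $$m+1+\sum_{i=1}^{N_1}\alpha_i+\sum_{i=N_1+1}^{N}\beta_i\neq0\qquad\text{for every integer } m\ge N .$$ Then $\{\phi_m\}_{m\ge0}$ is a basis of $\mathbb R[x]$, and every integral $I_m=\int x^mK(x)\,dx$ with $m\ge N$ is reducible to $I_0,\ldots,I_{N-1}$ and explicit boundary terms; that is, $I_m=\sum_{j=0}^{N-1}r_jI_j+F(x)+C$ for some real constants $r_j$ and some finite real linear combination $F$ of the functions $x^{k-N+1}P(x)K(x)$ with integers $k\ge N$.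
   Context: On the interval considered, real branches of the factors are chosen, no linear factor vanishes, and $$\frac{K'(x)}{K(x)}=\sum_{i=1}^{N_1}\frac{\alpha_i}{x-x_i}-\sum_{i=N_1+1}^{N}\frac{\beta_ix_i}{1-x_ix}.$$ Put $P(x)=\prod_{i=1}^{N_1}(x-x_i)\prod_{i=N_1+1}^{N}(1-x_ix)$ (of degree $N$ with leading coefficient $\lambda$) and $W(x)=P'(x)+P(x)\frac{K'(x)}{K(x)}$, which is a polynomial of degree at most $N-1$. Write $P(x)=\sum_{j=0}^{N}a_jx^j$, $W(x)=\sum_{j=0}^{N-1}b_jx^j$, with $a_j=0$ and $b_j=0$ for $j$ outside these ranges. For $0\le m\le N-1$ put $\phi_m(x)=x^m$; for $m\ge N$ put $$\phi_m(x)=\sum_{l=m-N}^{m}\bigl[(m-N+1)a_{l-m+N}+b_{l-m+N-1}\bigr]x^l .$$ $\int f\,dx$ denotes an antiderivative of $f$ on the interval; identities hold up to an additive constant $C$. *)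

(* Defs.v *)
From mathcomp Require Import all_boot all_order all_algebra.
From mathcomp Require Import all_classical all_reals all_analysis.

Set Implicit Arguments.
Unset Strict Implicit.
Unset Printing Implicit Defensive.

Import Order.TTheory GRing.Theory Num.Theory.
Import numFieldNormedType.Exports.

Local Open Scope classical_set_scope.
Local Open Scope ring_scope.

(* The value of a real branch of l^g at t has modulus |l t|^g, and conversely
   a branch is a continuous selection.  When l does not vanish on J, the
   predicate below therefore says f = s |l|^g on J with a constant sign s;
   it makes no assumption on which sign is chosen. *)
Definition real_branch (R : realType) (J : set R) (l : R -> R) (g : R)
    (f : R -> R) : Prop :=
  {within J, continuous f} /\
  (forall t, J t -> `|f t| = `|l t| `^ g).

(* The indices 1..N of the factors are shifted to 0..N-1, so the factors
   (X - x_i) are those with i < N1.  Only the values alpha i for i < N1 and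
   beta i for N1 <= i matter. *)
Definition is_kernel (R : realType) (J : set R) (N N1 : nat)
    (x alpha beta : 'I_N -> R) (K : R -> R) : Prop :=
  exists f : 'I_N -> R -> R,
    [/\ forall i : 'I_N, (i < N1)%N ->
          real_branch J (fun t => t - x i) (alpha i) (f i),
        forall i : 'I_N, (N1 <= i)%N ->
          real_branch J (fun t => 1 - x i * t) (beta i) (f i)
      & forall t, J t ->
          K t = (\prod_(i < N | (i < N1)%N) f i t) *
                (\prod_(i < N | (N1 <= i)%N) f i t)].

Definition Ppoly (R : realType) (N N1 : nat) (x : 'I_N -> R) : {poly R} :=
  (\prod_(i < N | (i < N1)%N) ('X - (x i)%:P)) *
  (\prod_(i < N | (N1 <= i)%N) (1 - x i *: 'X)).

Definition coefz (R : realType) (p : {poly R}) (k : int) : R :=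
  if k is Posz n then p`_n else 0.

Definition phi (R : realType) (N : nat) (P W : {poly R}) (m : nat) : {poly R} :=
  if (m < N)%N then 'X^m
  else \sum_(m - N <= l < m.+1)
    ((m - N + 1)%:R * coefz P (l%:Z - m%:Z + N%:Z)
     + coefz W (l%:Z - m%:Z + N%:Z - 1)) *: 'X^l.

Definition is_basis (R : realType) (V : lmodType R) (v : nat -> V) : Prop :=
  (forall (n : nat) (c : nat -> R),
     \sum_(m < n) c m *: v m = 0 -> forall m, (m < n)%N -> c m = 0) /\
  (forall u : V, exists (n : nat) (c : nat -> R), u = \sum_(m < n) c m *: v m).

(* J may contain its endpoints; there, continuity replaces the one-sided
   derivative. *)
Definition antiderivative (R : realType) (J : set R) (F f : R -> R) : Prop :=
  {within J, continuous F} /\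
  (forall t, J° t -> is_derive t 1 F (f t)).

(* Main.v *)
(* For n >= 0 the logarithmic derivative of K gives
     (t^(n+1) P K)' = ((n+1) t^n P + t^(n+1) W) K,
   and the bracket is phi_m for m = n + N.  Its coefficient of degree m is
   lambda (m + 1 + sum alpha + sum beta), which is nonzero, so deg phi_m = m for
   every m and the phi_m form a triangular basis.  Expanding t^m on
   phi_0, ..., phi_m, multiplying by K and integrating gives the reduction. *)

Require Import Defs.
From mathcomp Require Import all_boot all_order all_algebra.
From mathcomp Require Import all_classical all_reals all_analysis.
From mathcomp Require Import ring lra zify.
Import Order.TTheory GRing.Theory Num.Theory.
Import numFieldNormedType.Exports.
Local Open Scope classical_set_scope.
Local Open Scope ring_scope.

Set Implicit Arguments.
Unset Strict Implicit.
Unset Printing Implicit Defensive.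

(** * Products of affine polynomials and the polynomial W *)

Lemma prod_affine_poly (R : comNzRingType) (I : Type) (c d : I -> R)
    (s : seq I) (p := \prod_(i <- s) (c i *: 'X + (d i)%:P)) :
  (size p <= (size s).+1)%N /\ p`_(size s) = \prod_(i <- s) c i.
Proof.
rewrite {}/p; elim: s => [|i s [IHs IHc]] /=.
  by rewrite !big_nil size_poly1 coefC.
rewrite !big_cons; set p := \prod_(j <- s) _ in IHs IHc *; split.
  apply: leq_trans (size_polyMleq _ _) _.
  have : (size (c i *: 'X + (d i)%:P)%R <= 2)%N.
    rewrite (leq_trans (size_polyD _ _))// geq_max.
    by rewrite (leq_trans (size_scale_leq _ _)) ?size_polyX//
      (leq_trans (size_polyC_leq1 _)).
  lia.
(* Only [c i *: 'X] reaches the new top degree: the size bound on [p] leaves nothing there for the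
   constant [d i]. *)
rewrite mulrDl -scalerAl coefD coefZ coefXM /= IHc mul_polyC coefZ.
by rewrite [p`__]nth_default ?mulr0 ?addr0.
Qed.

Lemma prod_affine_poly_in (R : comNzRingType) (I : finType) (A : {pred I})
    (c d : I -> R) (p := \prod_(i in A) (c i *: 'X + (d i)%:P)) :
  (size p <= #|A|.+1)%N /\ p`_#|A| = \prod_(i in A) c i.
Proof.
rewrite {}/p -big_enum -[\prod_(i in A) c i]big_enum /= cardE.
exact: prod_affine_poly.
Qed.

(** This is P' + P K'/K for K the product of the (c_i X + d_i)^(g_i): in each term g_i c_i P / (c_i
    X + d_i) the denominator is already cancelled, so the expression is a polynomial by
    construction. *)
Definition logder_poly (R : comNzRingType) (N : nat) (c d g : 'I_N -> R)
    : {poly R} :=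
  (\prod_i (c i *: 'X + (d i)%:P))^`() +
  \sum_i (g i * c i) *: \prod_(j in predC1 i) (c j *: 'X + (d j)%:P).

Lemma size_logder_poly (R : comNzRingType) (N : nat) (c d g : 'I_N -> R) :
  (size (logder_poly c d g) <= N)%N.
Proof.
case: N c d g => [|n] c d g.
  by rewrite /logder_poly !big_ord0 derivC addr0 size_poly0.
rewrite (leq_trans (size_polyD _ _))// geq_max; apply/andP; split.
  have [sP _] := prod_affine_poly_in (mem 'I_n.+1) c d.
  rewrite card_ord in sP.
  rewrite (leq_trans (size_poly _ _))// -ltnS.
  by case: size sP.
apply: (leq_trans (size_sum _ _ _)); apply/bigmax_leqP => i _.
have [sP _] := prod_affine_poly_in (predC1 i) c d.
by rewrite (leq_trans (size_scale_leq _ _))// (leq_trans sP)// cardC1 card_ord.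
Qed.

(** The derivative contributes N times the product of the c_i. The i-th summand contributes g_i
    times the same product, its prefactor c_i replacing the omitted factor. *)
Lemma coef_logder_poly (R : comNzRingType) (N : nat) (c d g : 'I_N -> R) :
  (0 < N)%N ->
  (logder_poly c d g)`_N.-1 = (\prod_i c i) * (N%:R + \sum_i g i).
Proof.
case: N c d g => // n c d g _ /=.
have [_ cP] := prod_affine_poly_in (mem 'I_n.+1) c d.
rewrite card_ord in cP.
rewrite coefD coef_deriv cP mulrDr mulr_natr; congr (_ + _).
rewrite coef_sum mulr_sumr; apply: eq_bigr => i _.
have [_] := prod_affine_poly_in (predC1 i) c d.
rewrite cardC1 card_ord /= coefZ => ->.
by rewrite [in RHS](bigD1 i) //= [RHS]mulrC mulrA.
Qed.

(** * The polynomials [phi] as cofactors of K in derivatives of boundary terms *)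

Definition boundary_poly (R : comNzRingType) (P W : {poly R}) (n : nat)
    : {poly R} :=
  n.+1%:R *: ('X^n * P) + 'X^(n.+1) * W.

(** Coefficients are compared degree by degree; multiplication by ['X^(m - N)] and ['X^(m - N).+1]
    produces exactly the index shifts in [phi]. *)
Lemma phiE (R : realType) (N m : nat) (P W : {poly R}) :
  (size P <= N.+1)%N -> (size W <= N)%N -> (N <= m)%N ->
  phi N P W m = boundary_poly P W (m - N).
Proof.
move=> sP sW Nm; rewrite /boundary_poly /phi ltnNge Nm /=.
apply/polyP => i; rewrite coef_sum coefD coefZ !coefXnM.
have ordE : forall l : nat, (m - N <= l)%N ->
    (m - N + 1)%:R * coefz P (l%:Z - m%:Z + N%:Z) + coefz W (l%:Z - m%:Z + N%:Z - 1)
    = (m - N).+1%:R * (if (l < m - N)%N then 0 else P`_(l - (m - N)))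
      + (if (l < (m - N).+1)%N then 0 else W`_(l - (m - N).+1)).
  move=> l ml; rewrite addn1 ltnNge ml /= ltnS.
  have -> : l%:Z - m%:Z + N%:Z = (l - (m - N))%N%:Z by lia.
  congr (_ + _); case: leqP => h.
    (* Here l = m - N, so W is read at index -1, where [coefz] is 0; on the other side the shift of
       W by one more degree also gives 0. *)
    by have -> : (l - (m - N))%N%:Z - 1 = Negz 0 by lia.
  by have -> : (l - (m - N))%N%:Z - 1 = (l - (m - N).+1)%N%:Z by lia.
under eq_bigr do rewrite coefZ coefXn.
have [/andP[h1 h2]|h] := boolP (m - N <= i < m.+1)%N.
  rewrite (bigD1_seq i) ?iota_uniq ?mem_index_iota ?h1//= eqxx mulr1 big1 ?addr0.
    exact: ordE.
  by move=> j ji; rewrite eq_sym (negbTE ji) mulr0.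
(* Outside the summation range, degrees below m - N vanish by the shifts and degrees above m by the
   size bounds on P and W. *)
rewrite big_nat big1; last first.
  move=> j hj; case: eqP => [e|]; last by rewrite mulr0.
  by rewrite -e (negbTE h) in hj.
case: ltnP => h3; first by rewrite ifT ?mulr0 ?addr0//; lia.
rewrite h3 /= -leqNgt in h; rewrite ifF; last lia.
by rewrite !nth_default ?mulr0 ?addr0 //;
  [apply: leq_trans sW _|apply: leq_trans sP _]; lia.
Qed.

(** For m >= N the summation range bounds the degree by m, and the quantity assumed nonzero is the
    coefficient of degree m. *)
Lemma size_phi (R : realType) (N m : nat) (P W : {poly R}) :
  (size P <= N.+1)%N -> (size W <= N)%N ->
  ((N <= m)%N -> (m - N).+1%:R * P`_N + W`_N.-1 != 0) -> (0 < N)%N ->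
  size (phi N P W m) = m.+1.
Proof.
move=> sP sW hm N0; have [mN|Nm] := ltnP m N; first by rewrite /phi mN size_polyXn.
apply/eqP; rewrite eqn_leq; apply/andP; split.
  rewrite /phi ltnNge Nm /=.
  apply: (leq_trans (size_sum _ _ _)); apply/bigmax_leqP_seq => l.
  rewrite mem_index_iota => /andP[_ lm] _.
  by rewrite (leq_trans (size_scale_leq _ _))// size_polyXn.
have : (phi N P W m)`_m != 0.
  rewrite phiE// /boundary_poly coefD coefZ !coefXnM !ifF; [|lia|lia].
  have -> : (m - (m - N) = N)%N by lia.
  have -> : (m - (m - N).+1 = N.-1)%N by lia.
  exact: hm.
by apply: contraNT; rewrite -leqNgt => ?; rewrite nth_default.
Qed.

(** * Triangular families of polynomials, and vanishing on an open set *)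

(** Subtracting the multiple of [v n] that cancels the coefficient of degree n lowers the size
    bound. Only indices below n occur, so ['X^m] will need no [phi] beyond index m. *)
Lemma triangular_span (R : fieldType) (v : nat -> {poly R}) :
  (forall m, size (v m) = m.+1) ->
  forall (n : nat) (u : {poly R}), (size u <= n)%N ->
  exists c : nat -> R, u = \sum_(m < n) c m *: v m.
Proof.
move=> sv; elim=> [|n IHn] u su.
  by exists (fun=> 0); rewrite big_ord0; apply/eqP; rewrite -size_poly_leq0.
have vn0 : (v n)`_n != 0.
  by have := sv n; rewrite -[X in _`_X]/(n.+1.-1) => <-;
    rewrite lead_coef_eq0 -size_poly_eq0 sv.
have [|c uE] := IHn (u - (u`_n / (v n)`_n) *: v n).
  apply/leq_sizeP => j; rewrite leq_eqVlt => /predU1P[<-|nj].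
    by rewrite coefB coefZ divfK ?subrr.
  by rewrite coefB coefZ (nth_default 0 (leq_trans su nj))
    [(v n)`_j]nth_default ?sv// mulr0 subr0.
exists (fun m => if m == n then u`_n / (v n)`_n else c m).
rewrite big_ord_recr /= eqxx -[LHS](subrK ((u`_n / (v n)`_n) *: v n)) uE.
by congr (_ + _); apply: eq_bigr => m _; rewrite (ltn_eqF (ltn_ord m)).
Qed.

Lemma triangular_basis (R : realType) (v : nat -> {poly R}) :
  (forall m, size (v m) = m.+1) -> is_basis v.
Proof.
move=> sv; split=> [|u]; last first.
  by exists (size u); apply: triangular_span.
elim=> [//|n IHn] c; rewrite big_ord_recr /= => h.
(* In degree n the earlier vectors have no coefficient, which isolates c_n times the leading
   coefficient of [v n]. *)
have cn : c n = 0.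
  have := congr1 (fun p : {poly R} => p`_n) h.
  rewrite coefD coefZ coef0 coef_sum big1 ?add0r; last first.
    by move=> i _; rewrite coefZ nth_default ?mulr0// sv.
  move/eqP; rewrite mulf_eq0 => /orP[/eqP//|].
  by rewrite -[X in _`_X]/(n.+1.-1) -{1}(sv n) -[_ == _]/(lead_coef _ == 0)
    lead_coef_eq0 -size_poly_eq0 sv.
move: h; rewrite cn scale0r addr0 => /IHn h m.
by rewrite ltnS leq_eqVlt => /predU1P[->|/h].
Qed.
Lemma poly_eq0_on_open (R : realType) (U : set R) (p : {poly R}) :
  open U -> U !=set0 -> (forall t, U t -> p.[t] = 0) -> p = 0.
Proof.
move=> oU [a Ua] p0.
have /nbhs_ballP[e /= e0 eU] : nbhs a U by exact: open_nbhs_nbhs.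
(* Distinct roots inside the ball of radius e: the shift to k + 2 keeps 1/(k + 2) strictly below 1.
   As many roots as the size of [p] force [p = 0]. *)
pose pt k := a + e * k.+2%:R^-1.
apply: (roots_geq_poly_eq0 (rs := [seq pt k | k <- iota 0 (size p)])).
- apply/allP => _ /mapP[k _ ->]; apply/eqP/p0/eU.
  rewrite -ball_normE /= /pt opprD addNKr normrN gtr0_norm ?mulr_gt0 ?invr_gt0//.
  by rewrite gtr_pMr// invf_lt1// ltr1n.
- rewrite map_inj_uniq ?iota_uniq// => k l /addrI /(mulfI (lt0r_neq0 e0)) /invr_inj.
  by move/eqP; rewrite eqr_nat => /eqP[].
- by rewrite size_map size_iota.
Qed.

(** * Differentiation of real branches and of their products *)

Lemma within_continuous_interior (R : realType) (J : set R) (f : R -> R) (t : R) :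
  {within J, continuous f} -> J° t -> {for t, continuous f}.
Proof.
move=> fJ Jt; have := fJ t.
by rewrite /continuous_at -(nbhs_subspace_interior Jt).
Qed.

(* Near t neither f nor l changes sign, so f = sg (f t) * (sg (l t) * l)^g. *)
Lemma real_branch_is_derive (R : realType) (J : set R) (l f : R -> R)
    (g dl t : R) :
  real_branch J l g f -> J° t -> is_derive t 1 l dl -> l t != 0 ->
  is_derive t 1 f (f t * (g * dl / l t)).
Proof.
move=> [fJ fl] Jt ld lt0.
have fct := within_continuous_interior fJ Jt.
have lct : {for t, continuous l}.
  by apply/differentiable_continuous/derivable1_diffP; case: ld.
have sg2 : forall a : R, a != 0 -> 0 < Num.sg a * a.
  by move=> a a0; rewrite -normrEsg normr_gt0.
have ft0 : f t != 0.
  by rewrite -normr_gt0 fl ?powR_gt0 ?normr_gt0//; exact: interior_subset.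
have sgK : forall a : R, a != 0 -> Num.sg a * Num.sg a = 1.
  by move=> a a0; rewrite -expr2 sqr_sg a0.
have nearsg (h : R -> R) : {for t, continuous h} -> h t != 0 ->
    \forall s \near t, `|h s| = Num.sg (h t) * h s.
  move=> hc ht0.
  have : \forall s \near t, 0 < Num.sg (h t) * h s.
    have : Num.sg (h t) * h s @[s --> t] --> Num.sg (h t) * h t by apply: cvgMr.
    by move=> /cvgr_gt; apply; exact: sg2.
  apply: filterS => s hs.
  by rewrite -(gtr0_norm hs) normrM normr_sg ht0 mul1r.
have fE : \forall s \near t, Num.sg (f t) * (Num.sg (l t) * l s) `^ g = f s.
  near=> s => /=.
  have <- : `|l s| = Num.sg (l t) * l s by near: s; exact: nearsg.
  rewrite -fl; last first.
    apply: interior_subset; near: s.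
    by apply: open_nbhs_nbhs; split => //; exact: open_interior.
  have -> : `|f s| = Num.sg (f t) * f s by near: s; exact: nearsg.
  by rewrite mulrA sgK ?mul1r.
apply: (near_eq_is_derive fE).
have pos := sg2 _ lt0.
have d1 : is_derive t 1 (fun s => Num.sg (l t) * l s) (Num.sg (l t) * dl).
  exact: is_deriveZ.
have d2 := is_derive1_powR g pos.
have d3 := @is_derive1_comp _ (fun s => s `^ g) (fun s => Num.sg (l t) * l s) t _ _ d2 d1.
have : is_derive t 1 (Num.sg (f t) \*: ((@powR R)^~ g \o (fun s => Num.sg (l t) * l s)))
   (Num.sg (f t) *: (g * (Num.sg (l t) * l t) `^ (g - 1) * (Num.sg (l t) * dl))).
  exact: is_deriveZ.
move/is_derive_eq; apply.
have ftE : f t = Num.sg (f t) * (Num.sg (l t) * l t) `^ g.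
  by rewrite -normrEsg -fl ?normrEsg ?mulrA ?sgK ?mul1r//; exact: interior_subset.
(* The exponent g - 1 becomes a division by sg(l t) l(t), whose sign cancels the one produced by the
   inner derivative. *)
rewrite [in RHS]ftE powRB ?(lt0r_neq0 pos) ?implybT// powRr1; last exact: ltW.
have sl0 : Num.sg (l t) != 0 by rewrite sgr_eq0.
by rewrite /GRing.scale /=; field; rewrite lt0 sl0.
Unshelve. all: by end_near. Qed.

(** With each derivative written as f_i q_i, the product rule merely adds the q_i, and no division
    occurs. *)
Lemma is_derive_prod (R : realType) (I : Type) (r : seq I) (f : I -> R -> R)
    (q : I -> R) (t : R) :
  (forall i, is_derive t 1 (f i) (f i t * q i)) ->
  is_derive t 1 (fun s => \prod_(i <- r) f i s)
    ((\prod_(i <- r) f i t) * \sum_(i <- r) q i).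
Proof.
move=> fd; elim: r => [|i r IHr].
  under eq_fun do rewrite big_nil.
  by rewrite !big_nil mulr0; exact: is_derive_cst.
under eq_fun do rewrite big_cons.
rewrite !big_cons.
have := is_deriveM (fd i) IHr.
by move/is_derive_eq; apply; rewrite /GRing.scale /=; ring.
Qed.

(** * Antiderivatives on an interval *)

(** The mean value theorem uses derivatives only inside a segment and continuity at its ends, so
    endpoints belonging to J are covered. *)
Lemma derive0_cst_on_interval (R : realType) (J : set R) (F : R -> R) :
  is_interval J -> {within J, continuous F} ->
  (forall t, J° t -> is_derive t 1 F 0) ->
  forall a b, J a -> J b -> F a = F b.
Proof.
move=> iJ cF dF.
have lt : forall a b, J a -> J b -> a < b -> F a = F b.
  move=> a b Ja Jb ab.
  have sub : `[a, b] `<=` J.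
    by move=> c /=; rewrite in_itv /= => cab; exact: iJ cab.
  have [c||c _] := @MVT_segment R F (fun=> 0) a b (ltW ab).
  - move=> cab; apply: dF.
    by apply: (interiorS sub); rewrite interior_itv_bnd.
  - exact: continuous_subspaceW cF.
  - by rewrite mul0r => /eqP; rewrite subr_eq0 => /eqP.
by move=> a b Ja Jb; have [/lt->|/lt->|->] := ltgtP a b.
Qed.

Lemma antiderivativeD (R : realType) (J : set R) (F G f g : R -> R) :
  antiderivative J F f -> antiderivative J G g ->
  antiderivative J (fun t => F t + G t) (fun t => f t + g t).
Proof.
move=> [cF dF] [cG dG]; split=> [t|t Jt]; first exact: cvgD (cF t) (cG t).
by apply: is_deriveD; [exact: dF|exact: dG].
Qed.

Lemma antiderivative_lincomb (R : realType) (J : set R) (I : Type) (r : seq I)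
    (a : I -> R) (F f : I -> R -> R) :
  (forall i, antiderivative J (F i) (f i)) ->
  antiderivative J (fun t => \sum_(i <- r) a i * F i t)
    (fun t => \sum_(i <- r) a i * f i t).
Proof.
move=> Ff; elim: r => [|i r IHr].
  under eq_fun do rewrite big_nil.
  under [X in antiderivative _ _ X]eq_fun do rewrite big_nil.
  split=> [t|t _]; [exact: cvg_cst|exact: is_derive_cst].
under eq_fun do rewrite big_cons.
under [X in antiderivative _ _ X]eq_fun do rewrite big_cons.
apply: antiderivativeD IHr; have [cF dF] := Ff i.
split=> [t|t Jt]; first exact: cvgMr (cF t).
exact: (is_deriveZ _ (dF t Jt)).
Qed.

Lemma antiderivative_unique (R : realType) (J : set R) (F G f g : R -> R) :
  is_interval J -> antiderivative J F f -> antiderivative J G g ->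
  (forall t, J° t -> f t = g t) ->
  exists C : R, forall t, J t -> F t = G t + C.
Proof.
move=> iJ [cF dF] [cG dG] fg.
have [[a Ja]|J0] := pselect (exists a, J a); last first.
  by exists 0 => t Jt; exfalso; apply: J0; exists t.
exists (F a - G a) => t Jt.
have : F t - G t = F a - G a.
  apply: (@derive0_cst_on_interval R J (F \- G)) => // [s|s Js].
    exact: cvgB (cF s) (cG s).
  have -> : 0 = f s - g s by rewrite fg// subrr.
  by apply: is_deriveB; [exact: dF|exact: dG].
lra.
Qed.

(** The function [q] stands for K'/K, so the product rule and W = P' + P q give the integrand. *)
Lemma antiderivative_boundary (R : realType) (J : set R) (P W : {poly R})
    (K q : R -> R) (n : nat) :
  {within J, continuous K} ->
  (forall t, J° t -> is_derive t 1 K (K t * q t)) ->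
  (forall t, J° t -> W.[t] = P^`().[t] + P.[t] * q t) ->
  antiderivative J (fun t => t ^+ n.+1 * P.[t] * K t)
    (fun t => (boundary_poly P W n).[t] * K t).
Proof.
move=> cK dK Wq.
have -> : (fun t => t ^+ n.+1 * P.[t] * K t) =
    (fun t => ('X^(n.+1) * P).[t] * K t).
  by apply/funext => t; rewrite hornerM hornerXn.
split=> [t|t Jt].
  have cp : {within J, continuous (horner ('X^(n.+1) * P))}.
    by apply: continuous_subspaceT => s; exact: continuous_horner.
  exact: cvgM (cp t) (cK t).
have := is_deriveM (is_derive_poly ('X^(n.+1) * P) t) (dK t Jt).
move/is_derive_eq; apply; rewrite /GRing.scale /= /boundary_poly.
rewrite derivM derivXn /= !(hornerD, hornerZ, hornerM, hornerMn, hornerXn) Wq//.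
by rewrite exprS; ring.
Qed.

(** * The kernel K and its logarithmic derivative *)

Lemma within_continuous_prod (R : realType) (J : set R) (I : Type) (r : seq I)
    (f : I -> R -> R) :
  (forall i, {within J, continuous (f i)}) ->
  {within J, continuous (fun t => \prod_(i <- r) f i t)}.
Proof.
move=> cf; exact: (@continuous_big R I *%R 1 xpredT mul_continuous
  (subspace J) r f (fun i _ => cf i)).
Qed.

Lemma is_derive_branch_prod (R : realType) (J : set R) (I : finType)
    (c d g : I -> R) (f : I -> R -> R) (K : R -> R) (t : R) :
  (forall i, real_branch J (fun s => c i * s + d i) (g i) (f i)) ->
  (forall s, J s -> K s = \prod_i f i s) ->
  J° t -> (forall i, c i * t + d i != 0) ->
  is_derive t 1 K (K t * \sum_i g i * c i / (c i * t + d i)).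
Proof.
move=> fb KE Jt l0.
rewrite (KE _ (interior_subset Jt)).
(* K equals the product only on J, but J is a neighbourhood of its interior point t. *)
apply: (@near_eq_is_derive _ _ _ (fun s => \prod_i f i s)).
  by apply: filterS Jt => s /KE.
apply: is_derive_prod => i; apply: (real_branch_is_derive (fb i) Jt) => //.
have := is_derive_poly (c i *: 'X + (d i)%:P)%R t.
rewrite derivD derivZ derivX derivC addr0 hornerZ hornerC mulr1.
by congr is_derive; apply/funext => s; rewrite hornerD hornerZ hornerX hornerC.
Qed.

Lemma horner_logder_poly (R : fieldType) (N : nat) (c d g : 'I_N -> R) (t : R)
    (P := \prod_i (c i *: 'X + (d i)%:P)) :
  (forall i, c i * t + d i != 0) ->
  (logder_poly c d g).[t] =
  P^`().[t] + P.[t] * \sum_i g i * c i / (c i * t + d i).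
Proof.
move=> l0; rewrite hornerD; congr (_ + _).
rewrite horner_sum mulr_sumr; apply: eq_bigr => i _.
have -> : P = (c i *: 'X + (d i)%:P) *
    \prod_(j in predC1 i) (c j *: 'X + (d j)%:P) by rewrite /P (bigD1 i).
rewrite hornerZ hornerM hornerD hornerZ hornerX hornerC.
by field; exact: l0.
Qed.

Theorem proposition3p1 (R : realType) (N N1 : nat) (hN1 : (N1 <= N)%N)
  (hN : (1 <= N)%N) (x alpha beta : 'I_N -> R)
  (halpha : forall i : 'I_N, (i < N1)%N -> `|alpha i| < 1)
  (hbeta : forall i : 'I_N, (N1 <= i)%N -> `|beta i| < 1)
  (J : set R) (hJ : is_interval J) (hJ0 : J° !=set0)
  (hnv1 : forall (i : 'I_N) (t : R), (i < N1)%N -> J t -> t - x i != 0)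
  (hnv2 : forall (i : 'I_N) (t : R), (N1 <= i)%N -> J t -> 1 - x i * t != 0)
  (K : R -> R) (hK : is_kernel J N1 x alpha beta K)
  (hlambda : (-1) ^+ (N - N1) * (\prod_(i < N | (N1 <= i)%N) x i) != 0)
  (W : {poly R})
  (hW : forall t : R, J° t ->
    W.[t] = (deriv (Ppoly N1 x)).[t] + (Ppoly N1 x).[t] * (derive1 K t / K t))
  (hres : forall m : nat, (N <= m)%N ->
    m%:R + 1 + (\sum_(i < N | (i < N1)%N) alpha i)
      + (\sum_(i < N | (N1 <= i)%N) beta i) != 0) :
  is_basis (phi N (Ppoly N1 x) W) /\
  (forall m : nat, (N <= m)%N ->
    exists (r : 'I_N -> R) (n : nat) (c : nat -> R),
      forall I : nat -> R -> R,
        (forall j : nat, antiderivative J (I j) (fun t => t ^+ j * K t)) ->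
        exists C : R, forall t : R, J t ->
          I m t = \sum_(j < N) r j * I j t
            + \sum_(N <= k < n) c k * (t ^+ (k - N + 1) * (Ppoly N1 x).[t] * K t)
            + C).

Proof.
(* Both kinds of factors take the common form c_i X + d_i with exponent g_i; the product of the c_i
   is lambda. *)
pose low (i : 'I_N) := (i < N1)%N.
pose c i := if low i then 1 else - x i.
pose d i := if low i then - x i else 1.
pose g i := if low i then alpha i else beta i.
have PE : Ppoly N1 x = \prod_i (c i *: 'X + (d i)%:P).
  rewrite (bigID low) /=; congr (_ * _).
    by apply: eq_bigr => i hi; rewrite /c /d /low hi scale1r polyCN.
  apply: eq_big => i; first by rewrite -leqNgt.
  by rewrite leqNgt => /negbTE hi; rewrite /c /d /low hi scaleNr addrC.
have lE i : (fun t => c i * t + d i) =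
    (if low i then fun t => t - x i else fun t => 1 - x i * t).
  by rewrite /c /d; case: ifP => _; apply/funext => t; ring.
have l0 i t : J t -> c i * t + d i != 0.
  move=> Jt; rewrite -[_ + _]/((fun t => c i * t + d i) t) lE.
  case: ifP => [|/negbT] hi; first exact: hnv1.
  by apply: hnv2; rewrite // leqNgt.
have c0 i : c i != 0.
  rewrite /c; case: ifP => [_|/negbT hi]; first exact: oner_neq0.
  move: hlambda; rewrite mulf_eq0 negb_or => /andP[_ /prodf_neq0 h].
  by rewrite oppr_eq0 h// leqNgt.
have gE : \sum_i g i = (\sum_(i < N | (i < N1)%N) alpha i)
      + (\sum_(i < N | (N1 <= i)%N) beta i).
  rewrite (bigID low) /=; congr (_ + _).
    by apply: eq_bigr => i hi; rewrite /g hi.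
  apply: eq_big => i; first by rewrite -leqNgt.
  by move=> /negbTE hi; rewrite /g hi.
have [f [fa fb fK]] := hK.
have br i : real_branch J (fun t => c i * t + d i) (g i) (f i).
  rewrite lE /g; case: ifP => [|/negbT] hi; first exact: fa.
  by apply: fb; rewrite leqNgt.
have KE t : J t -> K t = \prod_i f i t.
  move=> /fK ->; rewrite [RHS](bigID low) /=; congr (_ * _).
  by apply: eq_bigl => i; rewrite -leqNgt.
have K0 t : J t -> K t != 0.
  move=> Jt; rewrite KE//; apply/prodf_neq0 => i _.
  by rewrite -normr_gt0 (br i).2// powR_gt0// normr_gt0 l0.
have cK : {within J, continuous K}.
  apply: (@subspace_eq_continuous _ _ _ (fun t => \prod_i f i t)).
    by move=> t /set_mem Jt; rewrite -KE.
  by apply: within_continuous_prod => i; exact: (br i).1.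
pose q t := \sum_i g i * c i / (c i * t + d i).
have dK t : J° t -> is_derive t 1 K (K t * q t).
  move=> Jt; apply: (is_derive_branch_prod br KE Jt) => i.
  by apply: l0; exact: interior_subset.
have Wq t : J° t -> W.[t] = (Ppoly N1 x)^`().[t] + (Ppoly N1 x).[t] * q t.
  move=> Jt; rewrite hW// derive1E; have := dK _ Jt => dKt.
  by rewrite derive_val mulrAC divff ?mul1r// K0//; exact: interior_subset.
(* W is known only through its values; agreement on the nonempty interior of J identifies it as a
   polynomial and yields its degree bound and top coefficient. *)
have WE : W = logder_poly c d g.
  apply/eqP; rewrite -subr_eq0; apply/eqP.
  apply: (poly_eq0_on_open (@open_interior _ J) hJ0) => t Jt.
  rewrite hornerD hornerN Wq// horner_logder_poly ?PE ?subrr// => i.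
  by apply: l0; exact: interior_subset.
have sP : (size (Ppoly N1 x) <= N.+1)%N /\ (Ppoly N1 x)`_N = \prod_i c i.
  by have := prod_affine_poly_in (mem 'I_N) c d; rewrite card_ord -PE.
have sW : (size W <= N)%N by rewrite WE size_logder_poly.
have sphi m : size (phi N (Ppoly N1 x) W m) = m.+1.
  apply: size_phi => // [|Nm]; first exact: sP.1.
  have -> : W`_N.-1 = (\prod_i c i) * (N%:R + \sum_i g i).
    by rewrite WE coef_logder_poly.
  (* The coefficient is lambda (m - N + 1) + lambda (N + sum g) = lambda (m + 1 + sum g), nonzero by
     [c0] and [hres]. *)
  rewrite sP.2 mulrC -mulrDr mulf_neq0//; first by apply/prodf_neq0 => i _.
  have := hres _ Nm; rewrite -addrA -gE.
  have -> : m%:R = (m - N)%:R + N%:R :> R by rewrite -natrD subnK.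
  by apply: contra_neq => h; rewrite -[RHS]h -natr1; ring.
split; first exact: triangular_basis.
move=> m Nm.
have [|a aE] := triangular_span (n := m.+1) (u := 'X^m) sphi.
  by rewrite size_polyXn.
(* The coordinates of ['X^m] below N serve as the r_j and those from N to m as boundary
   coefficients, all fixed before the antiderivatives [I] are given. *)
exists (fun i => a i), m.+1, a => I hI.
have bd k : antiderivative J
    (fun t => t ^+ (k - N + 1) * (Ppoly N1 x).[t] * K t)
    (fun t => (boundary_poly (Ppoly N1 x) W (k - N)).[t] * K t).
  by rewrite addn1; exact: antiderivative_boundary cK dK Wq.
(* Uniqueness up to a constant reduces the claim to equality of integrands on the interior of J. *)
apply: (antiderivative_unique hJ (hI m) (antiderivativeD
  (antiderivative_lincomb (index_enum 'I_N) (fun i => a i) (fun i => hI i))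
  (antiderivative_lincomb (index_iota N m.+1) a bd))) => t Jt.
rewrite -hornerXn aE horner_sum mulr_suml.
rewrite -(big_mkord xpredT (fun k => (a k *: phi N (Ppoly N1 x) W k).[t] * K t)).
(* The expansion splits at N: below it [phi] is a monomial, from N on it is a [boundary_poly]. *)
rewrite (@big_cat_nat _ _ _ N) ?(leqW Nm)//=; congr (_ + _).
  rewrite big_mkord; apply: eq_bigr => i _.
  by rewrite /phi ltn_ord hornerZ hornerXn mulrA.
rewrite !big_nat; apply: eq_bigr => k /andP[Nk _].
by rewrite phiE ?sP.1// hornerZ mulrA.
Qed.
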